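(* Let $a,b$ be relatively prime integers with $2\le a<b$. Then the number of exceptional values with respect to $a$ and $b$ is exactly $\frac{(a-3)(b-1)}{2}+\left\lfloor \frac{b}{a}\right\rfloor$.
   Context: For relatively prime positive integers $a_1,\dots,a_n$ (each at least 2), the Frobenius number $g(a_1,\dots,a_n)$ is the largest integer not representable as a nonnegative integer linear combination of $a_1,\dots,a_n$. Given relatively prime $a<b$, an integer $c>b$ (with $a,b,c$ relatively prime) is called an exceptional value with respect to $a$ and $b$ if $g(a,b,c)<g(a,b)$. *)

(* Defs.v *)
From mathcomp Require Import all_boot all_order all_algebra.
From mathcomp Require Import finmap.
From mathcomp Require Import boolp classical_sets cardinality.

Set Implicit Arguments.
Unset Strict Implicit.
Unset Printing Implicit Defensive.

Import Order.TTheory GRing.Theory Num.Theory.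

Local Open Scope classical_set_scope.
Local Open Scope ring_scope.

Definition representable (s : seq nat) (m : int) : Prop :=
  exists k : nat -> nat, m = (\sum_(i < size s) k i * nth 0 s i)%N%:Z.

Definition is_frobenius (s : seq nat) (g : int) : Prop :=
  ~ representable s g /\ forall m : int, ~ representable s m -> m <= g.

(* The default value 0 is only used when no largest non-representable integer
   exists (e.g. when the gcd of [s] is not 1). *)
Definition frobenius (s : seq nat) : int :=
  xget 0 [set g : int | is_frobenius s g].

Lemma is_frobenius_inj (s : seq nat) (g h : int) :
  is_frobenius s g -> is_frobenius s h -> g = h.
Proof.
by move=> [ng maxg] [nh maxh]; apply/le_anti; rewrite maxh // maxg.
Qed.

Lemma frobeniusE (s : seq nat) (g : int) : is_frobenius s g -> frobenius s = g.
Proof.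
move=> fg; rewrite /frobenius.
by apply: (is_frobenius_inj _ fg); apply: (xgetPex 0 (P := is_frobenius s)); exists g.
Qed.

Definition exceptional (a b c : nat) : Prop :=
  [/\ (b < c)%N, gcdn (gcdn a b) c = 1%N
    & frobenius [:: a; b; c] < frobenius [:: a; b]].

(* Main.v *)
Require Import Defs.
From mathcomp Require Import all_boot all_order all_algebra.
From mathcomp Require Import finmap.
From mathcomp Require Import boolp classical_sets cardinality.
From mathcomp Require Import zify ring lra.

(** The semigroup generated by a and b is symmetric: with N = (a-1)(b-1),
exactly one of m and N - 1 - m is representable, for every integer m.  In any
symmetric semigroup N - 1 is the Frobenius number g, and adjoining a generator
c lowers it iff g - kc is representable for some k, iff some kc is not
representable, iff c itself is not.  So the exceptional values are the gaps
above b.  The symmetry shows that there are N/2 gaps in all; those below b are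
the numbers below b that are not multiples of a. *)

Set Implicit Arguments.
Unset Strict Implicit.
Unset Printing Implicit Defensive.

Import Order.TTheory GRing.Theory Num.Theory.

Local Open Scope classical_set_scope.
Local Open Scope ring_scope.

Lemma card_fset_set_seq (T : choiceType) (s : seq T) :
  uniq s -> #|` fset_set [set` s]|%fset = size s.
Proof.
move=> uniq_s; have -> : [set` s] = [set` [fset x in s]%fset].
  by apply/seteqP; split=> x /=; rewrite inE.
by rewrite set_fsetK card_fseq undup_id.
Qed.

Lemma count_dvdn (d n : nat) : (count (dvdn d) (iota 0 n.+1) = (n %/ d).+1)%N.
Proof.
rewrite /= dvdn0 divn_count_dvd -sum1_count [in LHS]big_mkcond /=.
by rewrite /index_iota subn1.
Qed.

Section Representable.

Variable s : seq nat.

Lemma representable_ge0 (m : int) : representable s m -> 0 <= m.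
Proof. by move=> [k ->]. Qed.

Lemma representable0 : representable s 0.
Proof. by exists (fun=> 0%N); rewrite big1. Qed.

Lemma representableM (k : nat) (m : int) :
  representable s m -> representable s (k%:Z * m).
Proof.
move=> [x ->]; exists (fun i => k * x i)%N.
rewrite -PoszM big_distrr /=; congr Posz.
by apply: eq_bigr => i _; rewrite mulnA.
Qed.

Lemma representable_rcons (c : nat) (m : int) :
  representable (rcons s c) m <->
  exists k : nat, representable s (m - k%:Z * c%:Z).
Proof.
split=> [[x ->]|[k [x mE]]].
  exists (x (size s)), x.
  rewrite size_rcons big_ord_recr /= nth_rcons ltnn eqxx PoszD PoszM addrK.
  by congr Posz; apply: eq_bigr => i _; rewrite nth_rcons ltn_ord.
exists (fun i => if i == size s then k else x i).
rewrite size_rcons big_ord_recr /= nth_rcons ltnn !eqxx PoszD PoszM.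
apply/eqP; rewrite -subr_eq mE; apply/eqP; congr Posz.
by apply: eq_bigr => i _; rewrite nth_rcons ltn_ord ltn_eqF.
Qed.

Lemma representable_rconsW (c : nat) (m : int) :
  representable s m -> representable (rcons s c) m.
Proof.
by move=> rep_m; apply/representable_rcons; exists 0%N; rewrite mul0r subr0.
Qed.

Lemma representable_rcons_last (c : nat) : representable (rcons s c) c.
Proof.
apply/representable_rcons; exists 1%N; rewrite mul1r subrr.
exact: representable0.
Qed.

Lemma representable_rcons_lt (c : nat) (m : int) :
  m < c%:Z -> representable (rcons s c) m <-> representable s m.
Proof.
move=> lt_mc; split; last exact: representable_rconsW.
move=> /representable_rcons[[|k]]; first by rewrite mul0r subr0.
by move=> /representable_ge0; nia.
Qed.

Lemma is_frobenius_exists (M : int) :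
  (forall m, ~ representable s m -> m <= M) -> exists g, is_frobenius s g.
Proof.
move=> max_M.
(* Shifted by one: the Frobenius number is -1 when every natural number is
   representable. *)
pose P n := `[< ~ representable s (n%:Z - 1) >].
have exP : exists n, P n by exists 0%N; apply/asboolP => /representable_ge0.
have ubP n : P n -> (n <= `|(M + 1)%R|)%N by move=> /asboolP/max_M; lia.
case: (ex_maxnP exP ubP) => n /asboolP nrep_n max_n.
exists (n%:Z - 1); split=> // m nrep_m.
have [|lt_m] := lerP m (-1); first by lia.
have [k mE] : exists k : nat, m = k%:Z - 1 by exists `|(m + 1)%R|%N; lia.
by have : (k <= n)%N; [apply/max_n/asboolP; rewrite -mE | lia].
Qed.

End Representable.

Lemma representable_singleton (a : nat) (m : int) :
  representable [:: a] m <-> exists k : nat, m = k%:Z * a%:Z.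
Proof.
by split=> [[x ->]|[k ->]]; [exists (x 0) | exists (fun=> k)]; rewrite big_ord1.
Qed.

Lemma frobenius_rcons_lt (s : seq nat) (c : nat) (g : int) :
  is_frobenius s g ->
  frobenius (rcons s c) < frobenius s <-> representable (rcons s c) g.
Proof.
move=> frob_g; have [_ max_g] := frob_g; rewrite (frobeniusE frob_g).
have max_rcons m : ~ representable (rcons s c) m -> m <= g.
  by move=> nrep_m; apply: max_g => /(representable_rconsW c).
have [h frob_h] := is_frobenius_exists max_rcons.
have [nrep_h max_h] := frob_h; rewrite (frobeniusE frob_h).
split=> [lt_hg|rep_g]; first by apply: contrapT => /max_h; rewrite leNgt lt_hg.
rewrite lt_neqAle max_rcons // andbT.
by apply/eqP => hE; rewrite hE in nrep_h.
Qed.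

Definition gap (s : seq nat) : pred nat := fun n => ~~ `[< representable s n >].

Lemma gapP (s : seq nat) (n : nat) : reflect (~ representable s n) (gap s n).
Proof. exact: asboolPn. Qed.

Definition symmetric_semigroup (s : seq nat) (N : nat) : Prop :=
  forall m : int, representable s m <-> ~ representable s (N%:Z - 1 - m).

Section SymmetricSemigroup.

Variables (s : seq nat) (N : nat).
Hypothesis sym_s : symmetric_semigroup s N.

Lemma symmetric_representable_ge (m : int) : N%:Z <= m -> representable s m.
Proof. by move=> le_Nm; apply/sym_s => /representable_ge0; lia. Qed.

Lemma symmetric_is_frobenius : is_frobenius s (N%:Z - 1).
Proof.
split=> [/sym_s|m nrep_m]; first by rewrite subrr; apply; exact: representable0.
have [|le_Nm] := ltP m N; first by lia.
by case: nrep_m; apply: symmetric_representable_ge.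
Qed.

Lemma symmetric_representable_rcons (c : nat) :
  representable (rcons s c) (N%:Z - 1) <-> ~ representable s c.
Proof.
split=> [/representable_rcons[k /sym_s]|nrep_c]; last first.
  by apply/representable_rcons; exists 1%N; apply/sym_s; rewrite mul1r subKr.
by rewrite subKr => nrep_kc /(representableM k).
Qed.

Lemma symmetric_frobenius_rcons_lt (c : nat) :
  frobenius (rcons s c) < frobenius s <-> gap s c.
Proof.
apply: iff_trans (frobenius_rcons_lt c symmetric_is_frobenius) _.
exact: iff_trans (symmetric_representable_rcons c) (rwP (gapP s c)).
Qed.

Lemma symmetric_gap_lt (n : nat) : gap s n -> (n < N)%N.
Proof.
move=> /gapP nrep_n; rewrite ltnNge; apply/negP => le_Nn.
exact/nrep_n/symmetric_representable_ge.
Qed.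

Lemma symmetric_gap_rev (n : nat) :
  (n < N)%N -> gap s (N - n.+1)%N = ~~ gap s n.
Proof.
move=> lt_nN; rewrite /gap negbK -asbool_neg; apply: asbool_equiv_eq.
have -> : (N - n.+1)%N%:Z = N%:Z - 1 - n%:Z by lia.
exact: iff_sym (sym_s n).
Qed.

Lemma symmetric_count_gap (M : nat) :
  (N <= M)%N -> (count (gap s) (iota 0 M)).*2 = N.
Proof.
move=> le_NM; rewrite -(subnKC le_NM) iotaD count_cat add0n.
rewrite [X in (_ + X)%N](eq_in_count (a2 := pred0)) => [|n]; last first.
  rewrite mem_iota => /andP[le_Nn _]; apply/negbTE/negP => /symmetric_gap_lt.
  by rewrite ltnNge le_Nn.
have -> : count (gap s) (iota 0 N) = (\sum_(i < N) gap s i)%N.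
  by rewrite -sum1_count big_mkcond -{1}(subn0 N) big_mkord.
rewrite count_pred0 addn0 -addnn {1}(reindex_inj rev_ord_inj) -big_split /=.
rewrite (eq_bigr (fun=> 1%N)) ?sum1_card ?card_ord // => i _.
by rewrite symmetric_gap_rev //; case: gap.
Qed.

End SymmetricSemigroup.

Lemma coprimez_normal_form (a b m : int) : a != 0 -> coprimez a b ->
  exists x y : int, 0 <= y < `|a| /\ m = x * a + y * b.
Proof.
move=> a_neq0 /coprimezP[[u v] /= uvE].
exists (m * u + (m * v %/ a)%Z * b), (m * v %% a)%Z.
split; first by rewrite modz_ge0 ?ltz_mod.
rewrite -[LHS]mulr1 -uvE mulrDr mulrDl -addrA !mulrA; congr (_ + _).
by rewrite {1}(divz_eq (m * v) a) mulrDl mulrAC.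
Qed.

Lemma representable_pair_normal_form (a b : nat) (x y : int) :
  coprime a b -> 0 <= y < a%:Z ->
  representable [:: a; b] (x * a%:Z + y * b%:Z) <-> 0 <= x.
Proof.
move=> co_ab /andP[y_ge0 lt_ya]; split=> [|x_ge0].
  move=> /(representable_rcons [:: a])[j /representable_singleton[k xyE]].
  have divE : (y - j%:Z) * b%:Z = (k%:Z - x) * a%:Z.
    by rewrite [RHS]mulrBl -xyE; ring.
  rewrite leNgt; apply/negP => x_lt0.
  have j_lt_y : 0 < y - j%:Z.
    by have : 0 < (y - j%:Z) * b%:Z; [rewrite divE mulr_gt0; lia | nia].
  have /dvdzP[q yjE] : (a %| y - j%:Z)%Z.
    by rewrite -(@Gauss_dvdzl _ _ b) ?coprimezE // divE dvdz_mull.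
  have q_gt0 : 0 < q by nia.
  by nia.
apply/(representable_rcons [:: a]); exists `|y|%N.
by apply/representable_singleton; exists `|x|%N; rewrite !gez0_abs // addrK.
Qed.

Lemma gap_pair_lt (a b n : nat) :
  (n < b)%N -> gap [:: a; b] n = ~~ (a %| n)%N.
Proof.
move=> lt_nb; congr (~~ _).
have rep_n : representable [:: a; b] n <-> representable [:: a] n.
  by apply: (representable_rcons_lt [:: a]); rewrite ltz_nat.
rewrite (asbool_equiv_eq rep_n); apply/asboolP/dvdnP => [|[k ->]].
  by move=> /representable_singleton[k [nE]]; exists k.
by apply/representable_singleton; exists k.
Qed.

Lemma gap_pair_last (a b : nat) : gap [:: a; b] b = false.
Proof.
by apply/negbF/asboolP; apply: (representable_rcons_last [:: a]).
Qed.

Lemma count_gap_pair_lt (a b : nat) : (0 < b)%N ->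
  (count (gap [:: a; b]) (iota 0 b) + b.-1 %/ a).+1%N = b.
Proof.
move=> b_gt0; rewrite -addnS -count_dvdn prednK //.
rewrite (eq_in_count (a2 := predC (dvdn a))) => [|n].
  by rewrite addnC count_predC size_iota.
by rewrite mem_iota => /gap_pair_lt.
Qed.

Section CoprimePair.

Variables (a b : nat).
Hypotheses (a_gt0 : (0 < a)%N) (b_gt0 : (0 < b)%N) (co_ab : coprime a b).

Lemma symmetric_semigroup_pair :
  symmetric_semigroup [:: a; b] (a.-1 * b.-1).
Proof.
move=> m.
have a_neq0 : a%:Z != 0 by lia.
have [|x [y [y_bound ->]]] := @coprimez_normal_form a b m a_neq0.
  by rewrite coprimezE.
have -> : (a.-1 * b.-1)%N%:Z - 1 - (x * a%:Z + y * b%:Z) =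
          (- 1 - x) * a%:Z + (a%:Z - 1 - y) * b%:Z.
  by rewrite PoszM !predn_int //; ring.
by rewrite !representable_pair_normal_form //; lia.
Qed.

Lemma count_gap_pair_ge :
  ((count (gap [:: a; b]) (iota b (a.-1 * b.-1)) + b.-1).*2 =
   a.-1 * b.-1 + (b.-1 %/ a).*2)%N.
Proof.
have := symmetric_count_gap symmetric_semigroup_pair (leq_addl b _).
rewrite iotaD count_cat add0n; have := count_gap_pair_lt a b_gt0.
by set N := (a.-1 * b.-1)%N; lia.
Qed.

Lemma exceptionalE (c : nat) :
  exceptional a b c <-> (b < c)%N /\ gap [:: a; b] c.
Proof.
have lt_frob : frobenius [:: a; b; c] < frobenius [:: a; b] <-> gap [:: a; b] c.
  exact: symmetric_frobenius_rcons_lt symmetric_semigroup_pair c.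
rewrite /exceptional (eqP co_ab) gcd1n.
by split=> [[lt_bc _ /lt_frob]|[lt_bc /lt_frob]].
Qed.

Lemma exceptional_setE :
  [set c | exceptional a b c] =
  [set` [seq c <- iota b (a.-1 * b.-1) | gap [:: a; b] c]].
Proof.
apply/seteqP; split=> c /=; rewrite mem_filter mem_iota.
  move=> /exceptionalE[lt_bc gap_c]; rewrite gap_c (ltnW lt_bc) ltn_addl //.
  exact: (symmetric_gap_lt symmetric_semigroup_pair).
move=> /and3P[gap_c le_bc _]; apply/exceptionalE; split=> //.
rewrite ltn_neqAle le_bc andbT; apply: contraTneq gap_c => <-.
by rewrite gap_pair_last.
Qed.

End CoprimePair.

Theorem theorem4 (a b : nat) (a_ge2 : (2 <= a)%N) (lt_ab : (a < b)%N)
    (co_ab : coprime a b) :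
  finite_set [set c : nat | exceptional a b c] /\
  (#|` fset_set [set c : nat | exceptional a b c]|%fset)%:R =
    (a%:R - 3) * (b%:R - 1) / 2 + (b %/ a)%N%:R :> rat.
Proof.
have a_gt0 : (0 < a)%N by lia.
have b_gt0 : (0 < b)%N by lia.
rewrite exceptional_setE //; split; first exact: finite_seq.
rewrite card_fset_set_seq ?filter_uniq ?iota_uniq // size_filter.
have a_ndvd_b : (a %| b)%N = false.
  by apply/negP => /gcdn_idPl; rewrite (eqP co_ab); lia.
have := count_gap_pair_ge a_gt0 b_gt0 co_ab.
rewrite divn_pred a_ndvd_b subn0 => /(congr1 (fun n => n%:R : rat)).
by rewrite -!muln2 -!subn1 !(natrM, natrD) !natrB //; lra.
Qed.
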